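(* Let $H_{\mathrm{cor},\mathbb{F}_3}$ be the corner hypergraph of the group $\mathbb{F}_3=\mathbb{Z}/3\mathbb{Z}$. Then $\beta(H_{\mathrm{cor},\mathbb{F}_3})\geq 7$, and thus $\Theta(H_{\mathrm{cor},\mathbb{F}_3})\geq 7$.
   Context: A directed $k$-uniform hypergraph is a pair $H=(V,E)$ with $V$ a finite set and $E$ a set of $k$-tuples of elements of $V$. The strong product $G\boxtimes H$ of directed $k$-uniform hypergraphs $G=(V_G,E_G)$, $H=(V_H,E_H)$ has vertex set $V_G\times V_H$, and $((g_1,h_1),\dots,(g_k,h_k))$ is an edge iff either ($g_1=\dots=g_k$ and $(h_1,\dots,h_k)\in E_H$), or ($(g_1,\dots,g_k)\in E_G$ and $h_1=\dots=h_k$), or ($(g_1,\dots,g_k)\in E_G$ and $(h_1,\dots,h_k)\in E_H$). $H^{\boxtimes n}$ is the $n$-fold strong product. An independent set of $H$ is a set $S\subseteq V$ such that no edge has all its coordinates in $S$; $\alpha(H)$ is the maximum size of an independent set, and $\Theta(H)=\lim_{n\to\infty}\alpha(H^{\boxtimes n})^{1/n}$. For a finite abelian group $G$, the corner hypergraph $H_{\mathrm{cor},G}$ is the directed $3$-uniform hypergraph with vertex set $G\times G$ and edge set $\{((g_1,g_2),(g_1+\lambda,g_2),(g_1,g_2+\lambda)) : g_1,g_2,\lambda\in G,\ \lambda\neq 0\}$. Combinatorial degeneration: for finite sets $I_1,\dots,I_k$ and $\Phi\subseteq\Psi\subseteq I_1\times\dots\times I_k$, we write $\Psi\unrhd\Phi$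 if there are maps $u_i:I_i\to\mathbb{Z}$ such that $\sum_i u_i(x_i)>0$ for every $x\in\Psi\setminus\Phi$ and $\sum_i u_i(x_i)=0$ for every $x\in\Phi$. For $H=(V,E)$, $\beta(H)$ is the largest size of $S\subseteq V$ with $E\cup\{(v,\dots,v):v\in V\}\unrhd\{(v,\dots,v):v\in S\}$. *)

(* Defs.v *)
From mathcomp Require Import all_boot all_order all_algebra.
From mathcomp Require Import all_classical all_reals all_analysis.

Set Implicit Arguments.
Unset Strict Implicit.
Unset Printing Implicit Defensive.

Import Order.TTheory GRing.Theory Num.Theory.
Import numFieldNormedType.Exports.

Local Open Scope ring_scope.

Record hypergraph (k : nat) := Hypergraph {
  vertex : finType;
  edges : {set k.-tuple vertex} }.

Definition strong_product (k : nat) (G H : hypergraph k) : hypergraph k :=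
  @Hypergraph k (vertex G * vertex H)%type
    [set e : k.-tuple (vertex G * vertex H) |
      let eG := [tuple of map fst e] in
      let eH := [tuple of map snd e] in
      [|| constant eG && (eH \in edges H),
          (eG \in edges G) && constant eH
        | (eG \in edges G) && (eH \in edges H)]].

(* One vertex and no edge: the unit of the strong product, up to isomorphism. *)
Definition point_hypergraph (k : nat) : hypergraph k :=
  @Hypergraph k unit finset.set0.

Definition strong_power (k : nat) (H : hypergraph k) (n : nat) : hypergraph k :=
  iter n (strong_product H) (point_hypergraph k).

Definition independent (k : nat) (H : hypergraph k) (S : {set vertex H}) : bool :=
  [forall e in edges H, ~~ all (mem S) e].

Definition alpha (k : nat) (H : hypergraph k) : nat :=
  \max_(S : {set vertex H} | independent S) #|S|.

(* If the sequence did not converge, [limn] would return 0; so a positive lower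
   bound on [Theta] includes the existence of the limit. *)
Definition Theta (R : realType) (k : nat) (H : hypergraph k) : R :=
  limn (fun n : nat => (alpha (strong_power H n))%:R `^ (n%:R^-1) : R).

Definition corner_hypergraph (G : finZmodType) : hypergraph 3 :=
  @Hypergraph 3 (G * G)%type
    [set e : 3.-tuple (G * G) |
      [exists g1 : G, exists g2 : G, exists l : G,
        (l != 0) && (e == [tuple (g1, g2); (g1 + l, g2); (g1, g2 + l)])]].

(* Combinatorial degeneration of [Psi] to [Phi], where the index sets of the
   k coordinates are all equal to V. *)
Definition degenerates (k : nat) (V : finType) (Psi Phi : {set k.-tuple V}) : Prop :=
  Phi \subset Psi /\
  exists u : 'I_k -> V -> int,
    (forall x, x \in Psi :\: Phi -> 0 < \sum_(i < k) u i (tnth x i)) /\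
    (forall x, x \in Phi -> \sum_(i < k) u i (tnth x i) = 0).

Definition diagonal (k : nat) (V : finType) (S : {set V}) : {set k.-tuple V} :=
  [set [tuple of nseq k v] | v in S].

Definition beta (k : nat) (H : hypergraph k) : nat :=
  \max_(S : {set vertex H} |
      `[< degenerates (edges H :|: diagonal k [set: vertex H]) (diagonal k S) >])
    #|S|.

(* Main.v *)
Require Import Defs.
From mathcomp Require Import all_boot all_order all_algebra.
From mathcomp Require Import all_classical all_reals all_analysis.
From mathcomp Require Import zify lra.

(* Suppose that H has no constant edge and that E(H) together with the diagonal
   degenerates to the diagonal over S through the maps u_i.  Summing the u_i over
   the coordinates gives maps U_i on the n-th power with sum_i U_i(v) = 0 for v in
   S^n, and sum_i U_i(e_i) > 0 for every edge e inside S^n.  Hence a fibre of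
   (U_1, .., U_k) in S^n is independent, and since there are only polynomially many
   fibres, alpha(H^n) >= |S|^n / poly(n).  As alpha(H^n) is supermultiplicative,
   Fekete's lemma gives the existence of the limit, and Theta(H) >= |S|.  For the
   corner hypergraph of F_3, explicit maps u_i achieve |S| = 7. *)

Set Implicit Arguments.
Unset Strict Implicit.
Unset Printing Implicit Defensive.

Import Order.TTheory GRing.Theory Num.Theory.
Import numFieldNormedType.Exports.

(** * Constant tuples *)

Lemma constant_tnth k (T : eqType) (e : k.-tuple T) :
  reflect (forall i j, tnth e i = tnth e j) (constant e).
Proof.
apply: (iffP idP) => [ce i j|eq_e].
  case: k e i j ce => [|k] e i j; first by case: i.
  rewrite (tuple_eta e) /= => /all_pred1P eqe.
  have aux (l : 'I_k.+1) : tnth [tuple of thead e :: behead_tuple e] l = thead e.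
    rewrite (tnth_nth (thead e)) /= eqe.
    case: l => -[|l] //= lt_l; rewrite nth_nseq; by case: ifP.
  by rewrite !aux.
case: k e eq_e => [|k] e eq_e; first by rewrite tuple0.
rewrite (tuple_eta e) /=; apply/allP => x /tnthP[i ->]; rewrite /= tnth_behead.
by rewrite (eq_e _ ord0) /thead.
Qed.

Lemma constant_tuple_map k (T U : eqType) (f : T -> U) (e : k.-tuple T) :
  injective f -> constant (map_tuple f e) = constant e.
Proof.
move=> f_inj; apply/constant_tnth/constant_tnth => eq_e i j.
  by apply: f_inj; have := eq_e i j; rewrite !tnth_map.
by rewrite !tnth_map (eq_e i j).
Qed.

Lemma constant_pair k (T U : eqType) (e : k.-tuple (T * U)) :
  constant e = constant (map_tuple fst e) && constant (map_tuple snd e).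
Proof.
apply/constant_tnth/andP => [eq_e|[/constant_tnth eq1 /constant_tnth eq2] i j].
  by split; apply/constant_tnth => i j; rewrite !tnth_map (eq_e i j).
have := eq1 i j; have := eq2 i j; rewrite !tnth_map.
by case: (tnth e i) (tnth e j) => [a b] [c d] /= -> ->.
Qed.

(** * Independent sets in products and under embeddings *)

Lemma leq_alpha k (H : hypergraph k) (S : {set vertex H}) :
  independent S -> (#|S| <= alpha H)%N.
Proof. by move=> indS; exact: (@leq_bigmax_cond _ _ (fun S : {set vertex H} => #|S|)). Qed.

(** For [k > 0] an edge has at least one entry, so the empty set is independent and the maximum runs
    over a nonempty family. *)
Lemma alpha_witness k (H : hypergraph k) :
  (0 < k)%N -> exists2 S : {set vertex H}, independent S & #|S| = alpha H.
Proof.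
move=> k_gt0; have ind0 : independent (finset.set0 : {set vertex H}).
  apply/forall_inP => e _; apply/negP => /allP/(_ (tnth e (Ordinal k_gt0))).
  by rewrite mem_tnth /= inE => /(_ isT).
rewrite /alpha (bigop.bigmax_eq_arg finset.set0) //.
by case: arg_maxnP => // S indS _; exists S.
Qed.

Lemma independent_setX k (G H : hypergraph k)
    (S : {set vertex G}) (T : {set vertex H}) :
  independent S -> independent T ->
  independent (finset.setX S T : {set vertex (strong_product G H)}).
Proof.
move=> /forall_inP indS /forall_inP indT; apply/forall_inP => e.
rewrite inE => edge_e; apply/negP => /allP eST.
have eS : all (mem S) [tuple of map fst e].
  by rewrite all_map; apply/allP => x /eST; rewrite /= inE => /andP[].
have eT : all (mem T) [tuple of map snd e].
  by rewrite all_map; apply/allP => x /eST; rewrite /= inE => /andP[].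
case/or3P: edge_e => /andP[e1 e2].
- by have := indT _ e2; rewrite eT.
- by have := indS _ e1; rewrite eS.
- by have := indT _ e2; rewrite eT.
Qed.

Lemma alpha_strong_product k (G H : hypergraph k) :
  (0 < k)%N -> (alpha G * alpha H <= alpha (strong_product G H))%N.
Proof.
move=> k_gt0; have [S indS <-] := alpha_witness G k_gt0.
have [T indT <-] := alpha_witness H k_gt0.
by rewrite -cardsX; apply/leq_alpha/independent_setX.
Qed.

(** The image of an independent [S] is independent: an edge inside [f @: S] lifts entrywise to a
    tuple in [S], which would be an edge of [G]. *)
Lemma leq_alpha_embedding k (G H : hypergraph k) (f : vertex G -> vertex H) :
  injective f ->
  (forall e : k.-tuple (vertex G), [tuple of map f e] \in edges H -> e \in edges G) ->
  (0 < k)%N -> (alpha G <= alpha H)%N.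
Proof.
move=> f_inj f_edge k_gt0; have [S /forall_inP indS <-] := alpha_witness G k_gt0.
rewrite -(card_imset _ f_inj); apply/leq_alpha/forall_inP => e edge_e.
apply/negP => /allP eS.
have [|v Sv eE] := @fin_all_exists2 _ _ (fun _ x => x \in S) (fun i x => tnth e i = f x).
  by move=> i; have /imsetP := eS _ (mem_tnth i e).
pose e' := mktuple v.
have e'E : [tuple of map f e'] = e.
  by apply: eq_from_tnth => i; rewrite tnth_map tnth_mktuple eE.
have := indS e'; rewrite f_edge ?e'E // => /(_ isT)/negP; apply.
by apply/allP => _ /tnthP[i ->]; rewrite tnth_mktuple; apply: Sv.
Qed.

Lemma in_edges_strong_product k (G H : hypergraph k)
    (e : k.-tuple (vertex G * vertex H)) :
  let eG := map_tuple fst e in let eH := map_tuple snd e in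
  (e \in edges (strong_product G H)) =
    [|| constant eG && (eH \in edges H), (eG \in edges G) && constant eH
      | (eG \in edges G) && (eH \in edges H)].
Proof. by rewrite inE. Qed.

Lemma in_edges_strong_powerS k (H : hypergraph k) n
    (e : k.-tuple (vertex H * vertex (strong_power H n))) :
  let eH := map_tuple fst e in let eP := map_tuple snd e in
  (e \in edges (strong_power H n.+1)) =
    [|| constant eH && (eP \in edges (strong_power H n)),
        (eH \in edges H) && constant eP
      | (eH \in edges H) && (eP \in edges (strong_power H n))].
Proof. exact: in_edges_strong_product. Qed.

(** * Concatenation of powers and supermultiplicativity *)

Fixpoint power_cat k (H : hypergraph k) m n :
    vertex (strong_product (strong_power H m) (strong_power H n)) ->
    vertex (strong_power H (m + n)) :=
  match m return vertex (strong_product (strong_power H m) (strong_power H n)) ->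
    vertex (strong_power H (m + n)) with
  | 0 => snd
  | m.+1 => fun v => (v.1.1, power_cat (v.1.2, v.2))
  end.

Lemma power_cat_inj k (H : hypergraph k) m n : injective (@power_cat k H m n).
Proof.
elim: m => [|m IHm] /=; first by move=> [[] x] [[] y] /= ->.
by move=> [[a x] y] [[b z] t] /= [-> /IHm[-> ->]].
Qed.

(** A tuple is an edge of a product iff each component is constant or an edge, and at least one is
    an edge. This description does not depend on the bracketing. *)
Lemma power_cat_edge k (H : hypergraph k) m n
    (e : k.-tuple (vertex (strong_product (strong_power H m) (strong_power H n)))) :
  [tuple of map (@power_cat k H m n) e] \in edges (strong_power H (m + n)) ->
  e \in edges (strong_product (strong_power H m) (strong_power H n)).
Proof.
elim: m e => [|m IHm] e.
  (* The first component lives in the one-point power, hence is constant. *)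
  rewrite /= => edge_e; rewrite inE; apply/orP; left; apply/andP; split=> //.
  by apply/constant_tnth => i j; rewrite !tnth_map; do 2!case: (tnth _ _).1.
pose e1 := map_tuple fst (map_tuple fst e).
pose e23 := map_tuple (fun v => (v.1.2, v.2)) e :
  k.-tuple (vertex (strong_product (strong_power H m) (strong_power H n))).
rewrite (in_edges_strong_powerS (map_tuple _ _)) in_edges_strong_product.
rewrite (in_edges_strong_powerS (map_tuple fst e)) constant_pair.
have -> : map_tuple fst (map_tuple (@power_cat k H m.+1 n) e) = e1.
  by apply: val_inj; rewrite /= -!map_comp.
have -> : map_tuple snd (map_tuple (@power_cat k H m.+1 n) e) =
          map_tuple (@power_cat k H m n) e23.
  by apply: val_inj; rewrite /= -!map_comp.
rewrite (constant_tuple_map _ (@power_cat_inj k H m n)) (constant_pair e23).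
have := IHm e23; move: (_ \in edges (strong_power H (m + n))) => b.
rewrite in_edges_strong_product.
have -> : map_tuple fst e23 = map_tuple snd (map_tuple fst e).
  by apply: val_inj; rewrite /= -!map_comp.
have -> : map_tuple snd e23 = map_tuple snd e.
  by apply: val_inj; rewrite /= -!map_comp.
rewrite -/e1.
(* With all memberships abstracted to Booleans, a propositional tautology remains. *)
move: (constant e1) (constant (map_tuple snd (map_tuple fst e))).
move: (constant (map_tuple snd e)) (e1 \in _) (_ \in _) (_ \in _).
by case: b; do 6!case=> //=; move/(_ isT).
Qed.


Lemma alpha_strong_powerD k (H : hypergraph k) m n : (0 < k)%N ->
  (alpha (strong_power H m) * alpha (strong_power H n)
     <= alpha (strong_power H (m + n)))%N.
Proof.
move=> k_gt0; apply: leq_trans (alpha_strong_product _ _ k_gt0) _.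
exact: leq_alpha_embedding (@power_cat_inj k H m n) (@power_cat_edge k H m n) k_gt0.
Qed.

Lemma alpha_strong_power_le k (H : hypergraph k) n :
  (alpha (strong_power H n) <= #|vertex H| ^ n)%N.
Proof.
have -> : (#|vertex H| ^ n = #|vertex (strong_power H n)|)%N.
  elim: n => [|n IHn]; first by rewrite card_unit.
  by rewrite expnS IHn; exact/esym/card_prod.
by apply/bigmax_leqP => S _; exact: max_card.
Qed.

(** * Weightings and the fibre bound *)

(* Degeneration weights, shifted so as to take values in [nat]. *)
Definition weighting k (H : hypergraph k) (S : {set vertex H})
    (w : 'I_k -> vertex H -> nat) (c D : nat) :=
  [/\ forall i v, (w i v <= D)%N,
      forall v, v \in S -> (\sum_(i < k) w i v = c)%N
    & forall e, e \in edges H -> all (mem S) e ->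
        (c < \sum_(i < k) w i (tnth e i))%N].

Lemma sum_constant_tuple k (V : finType) (S : {set V}) (w : 'I_k.+1 -> V -> nat) c
    (e : k.+1.-tuple V) :
  (forall v, v \in S -> (\sum_(i < k.+1) w i v = c)%N) ->
  all (mem S) e -> constant e -> (\sum_(i < k.+1) w i (tnth e i) = c)%N.
Proof.
move=> sum_w /allP eS /constant_tnth eq_e.
rewrite -(sum_w _ (eS _ (mem_tnth ord0 e))).
by apply: eq_bigr => i _; rewrite (eq_e i ord0).
Qed.

(** In each kind of product edge, one component is an edge and exceeds its constant strictly, while
    the other is constant or an edge and does not fall below its own. *)
Lemma weighting_strong_product k (G H : hypergraph k.+1) S T w w' c c' D D' :
  @weighting _ G S w c D -> @weighting _ H T w' c' D' ->
  @weighting _ (strong_product G H) (finset.setX S T)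
    (fun i v => w i v.1 + w' i v.2)%N (c + c') (D + D').
Proof.
move=> [w_le w_sum w_edge] [w'_le w'_sum w'_edge]; split.
- by move=> i v; apply: leq_add.
- move=> v; rewrite inE => /andP[Sv Tv].
  by rewrite big_split /= w_sum // w'_sum.
move=> e edge_e /allP eST; rewrite big_split /=.
have eS : all (mem S) (map_tuple fst e).
  by rewrite all_map; apply/allP => x /eST; rewrite /= inE => /andP[].
have eT : all (mem T) (map_tuple snd e).
  by rewrite all_map; apply/allP => x /eST; rewrite /= inE => /andP[].
have -> : (\sum_i w i (tnth e i).1 = \sum_i w i (tnth (map_tuple fst e) i))%N.
  by apply: eq_bigr => i _; rewrite tnth_map.
have -> : (\sum_i w' i (tnth e i).2 = \sum_i w' i (tnth (map_tuple snd e) i))%N.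
  by apply: eq_bigr => i _; rewrite tnth_map.
move: edge_e; rewrite in_edges_strong_product => /or3P[] /andP[e1 e2].
- by rewrite (sum_constant_tuple w_sum) // ltn_add2l w'_edge.
- by rewrite (sum_constant_tuple w'_sum) // ltn_add2r w_edge.
- by rewrite -addSn; apply: leq_add; [exact: w_edge|exact/ltnW/w'_edge].
Qed.

(** The point is that the range [n * D] of the weights grows only linearly in [n], so the number of
    fibres is polynomial. *)
Lemma weighting_strong_power k (H : hypergraph k.+1) S w c D n :
  @weighting _ H S w c D ->
  exists (Sn : {set vertex (strong_power H n)}) wn,
    weighting Sn wn (n * c) (n * D) /\ #|Sn| = (#|S| ^ n)%N.
Proof.
move=> wS; elim: n => [|n [Sn [wn [wSn cardSn]]]].
  exists [set: unit], (fun _ _ => 0%N); split; last by rewrite cardsT card_unit.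
  by split=> // [v _|e]; rewrite ?inE // big1.
exists (finset.setX S Sn), (fun i v => w i v.1 + wn i v.2)%N; split.
  by rewrite !mulSn; apply: weighting_strong_product.
by rewrite expnS -cardSn; exact: cardsX.
Qed.

(* On a fibre of [v |-> (w i v)_i] inside [S] every tuple of vertices has total
   weight [c], hence is not an edge; there are at most [D.+1 ^ k.+1] fibres. *)
Lemma weighting_alpha k (H : hypergraph k.+1) S w c D :
  @weighting _ H S w c D -> (#|S| <= D.+1 ^ k.+1 * alpha H)%N.
Proof.
move=> [w_le w_sum w_edge].
(* [inord] loses nothing here, since [w_le] bounds the weights by [D]. *)
pose F v : {ffun 'I_k.+1 -> 'I_D.+1} := [ffun i => inord (w i v)].
rewrite -sum1_card (partition_big F predT) //=.
apply: (@leq_trans (\sum_(f : {ffun 'I_k.+1 -> 'I_D.+1}) alpha H)%N); last first.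
  by rewrite sum_nat_const card_ffun !card_ord.
apply: leq_sum => f _; pose A := [set v in S | F v == f].
rewrite (eq_bigl (mem A)); last by move=> v; rewrite /= inE.
rewrite sum1_card; apply/leq_alpha/forall_inP => e edge_e; apply/negP => /allP eA.
have eS : all (mem S) e by apply/allP => x /eA; rewrite /= inE => /andP[].
have := w_edge e edge_e eS; rewrite ltnNge => /negP; apply.
(* Within a fibre, [e] has the same total weight as the constant tuple at its entry [ord0]. *)
have -> : c = (\sum_(i < k.+1) w i (tnth e ord0))%N.
  by rewrite w_sum //; exact: (allP eS _ (mem_tnth _ _)).
apply: leq_sum => i _.
have FA j : F (tnth e j) = f.
  by have := eA _ (mem_tnth j e); rewrite /= inE => /andP[_ /eqP].
have /ffunP/(_ i)/(congr1 val) := etrans (FA i) (esym (FA ord0)).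
by rewrite !ffunE /= !inordK ?ltnS // => ->.
Qed.

(** * From degenerations to weightings *)

(** A constant edge at a vertex of [S] would lie on the diagonal and have total weight 0, against
    the strict inequality for edges. *)
Definition loopless k (H : hypergraph k) :=
  forall e, e \in edges H -> ~~ constant e.

(** Adding [M] to every [u i] makes all values nonnegative and shifts every total by [k * M], which
    becomes the constant of the weighting. *)
Lemma degenerates_weighting k (H : hypergraph k) (S : {set vertex H}) :
  loopless H ->
  degenerates (edges H :|: Defs.diagonal k [set: vertex H]) (Defs.diagonal k S) ->
  exists w c D, weighting S w c D.
Proof.
move=> noloop [_ [u [u_gt0 u_eq0]]].
pose M := (\sum_(i < k) \sum_v `|u i v|)%N.
have uM i v : (`|u i v| <= M)%N.
  by rewrite /M (bigD1 i) //= (bigD1 v) //= -addnA leq_addr.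
have ge0 i v : (0 <= u i v + M%:Z)%R by have := uM i v; lia.
pose w i v := `|(u i v + M%:Z)%R|%N.
have sumE (x : 'I_k -> vertex H) :
    ((\sum_(i < k) w i (x i))%N%:Z = \sum_(i < k) u i (x i) + (k * M)%N%:Z)%R.
  rewrite (big_morph Posz PoszD (erefl _)) PoszM.
  under eq_bigr => i _ do rewrite gez0_abs //.
  by rewrite big_split /= sumr_const card_ord -mulr_natl natz.
exists w, (k * M)%N, (M + M)%N; split.
- by move=> i v; have := uM i v; have := ge0 i v; rewrite /w; lia.
- move=> v Sv; apply/eqP; rewrite -eqz_nat (sumE (fun=> v)).
  have := u_eq0 [tuple of nseq k v]; rewrite imset_f // => /(_ isT).
  under eq_bigr => i _ do rewrite (tnth_nth v) nth_nseq ltn_ord.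
  by move=> ->; rewrite add0r.
move=> e edge_e eS; rewrite -ltz_nat sumE ltrDr; apply: u_gt0.
rewrite !inE edge_e /= andbT; apply: contra (noloop e edge_e) => /imsetP[v _ ->].
apply/constant_tnth => i j.
by rewrite !(tnth_nth v) !nth_nseq !ltn_ord.
Qed.

Lemma loopless_corner (G : finZmodType) : loopless (corner_hypergraph G).
Proof.
move=> e; rewrite inE => /existsP[g1 /existsP[g2 /existsP[l /andP[l_neq0 /eqP->]]]].
apply: contra l_neq0 => /constant_tnth/(_ (inord 1) (inord 0)).
rewrite !(tnth_nth (g1, g2)) !inordK //= => -[].
by rewrite -[in RHS](addr0 g1) => /addrI->.
Qed.

(** * Superadditive sequences and logarithmic errors *)

Local Open Scope ring_scope.

(** Fekete's lemma; [L] is the supremum of the ratios [b n / n] over positive [n]. *)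
Lemma fekete_superadditive (R : realType) (b : nat -> R) (c : R) :
  (forall n, 0 <= b n) -> (forall m n, b m + b n <= b (m + n)%N) ->
  (forall n, b n <= n%:R * c) ->
  exists2 L : R, ((fun n => b n / n%:R) @ \oo --> L)%classic
    & forall n, b n <= n%:R * L.
Proof.
move=> b_ge0 b_add b_le; pose A := [set b n.+1 / n.+1%:R | n in [set: nat]]%classic.
have supA : has_sup A.
  split; first by exists (b 1%N / 1), 0%N.
  by exists c => _ [n _ <-]; rewrite ler_pdivrMr // mulrC.
have b_sup n : b n <= n%:R * sup A.
  case: n => [|n]; first by have := b_le 0%N; rewrite !mul0r.
  by rewrite mulrC -ler_pdivrMr //; apply: ub_le_sup; [case: supA | exists n].
exists (sup A) => //.
have bM q m : q%:R * b m <= b (q * m)%N.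
  elim: q => [|q IHq]; first by rewrite mul0r.
  by rewrite mulSn mulrSr mulrDl mul1r addrC; apply: le_trans (b_add _ _); rewrite lerD2l.
apply/cvgrPdist_le => e e_gt0.
have [|_ [m _ <-] m_sup] := @sup_adherent _ A (e / 2) _ supA; first exact: divr_gt0.
set B := b m.+1 in m_sup; set s := B / m.+1%:R in m_sup.
have s_ge0 : 0 <= s by apply: divr_ge0; [exact: b_ge0 | exact: ler0n].
have BE : B = m.+1%:R * s by rewrite mulrC divfK.
(* Beyond this threshold one block [B] costs at most [n * (e / 2)]; the other [e / 2] is the
   distance of [s] from the supremum. *)
exists (Num.truncn (2 * B / e)).+1 => // n /= lt_n.
have n_gt0 : 0 < n%:R :> R by rewrite ltr0n; case: n lt_n.
have {lt_n}leB : B <= n%:R * (e / 2).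
  have : 2 * B / e <= n%:R.
    by apply: le_trans (ltW (truncnS_gt _)) _; rewrite ler_nat.
  rewrite ler_pdivrMr //; lra.
rewrite ger0_norm ?subr_ge0; last by rewrite ler_pdivrMr // mulrC.
rewrite lerBlDr -lerBlDl ler_pdivlMr //.
pose q := (n %/ m.+1)%N.
have le_b : q%:R * B <= b n.
  apply: le_trans (bM _ _) _; rewrite {1}(divn_eq n m.+1).
  by apply: le_trans (b_add _ _); rewrite lerDl.
(* Rounding [n] up to a multiple of [m.+1] adds a single block [B] to the [q] blocks bounded by
   [b n]. *)
have : n%:R <= (q.+1 * m.+1)%N%:R :> R.
  by rewrite ler_nat ltnW // ltn_ceil.
rewrite natrM mulrSr => /(ler_wpM2r s_ge0).
have := ler_wpM2l (ltW n_gt0) (ltW m_sup).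
by rewrite -mulrA -BE; lra.
Qed.

(** If [d > L], take [n = m ^ 2]: the error is at most [2 * k * m * D], linear in [m], against the
    gap [m ^ 2 * (d - L)]. *)
Lemma le_of_log_error (R : realType) (L d : R) (D k : nat) :
  (forall n : nat, n%:R * d <= n%:R * L + k%:R * ln (n * D).+1%:R) -> d <= L.
Proof.
move=> dL; rewrite leNgt; apply/negP => ltLd.
have dL_gt0 : 0 < d - L by rewrite subr_gt0.
pose m := (Num.truncn (2 * D%:R * k%:R / (d - L))).+1.
have : 2 * D%:R * k%:R < m%:R * (d - L) by rewrite -ltr_pdivrMr // truncnS_gt.
apply/negP; rewrite -leNgt.
have ln_le : ln (m * m * D).+1%:R <= 2 * (m%:R * D%:R) :> R.
  (* Passing to a square first gains a square root over the estimate [ln (1 + x) <= x]. *)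
  apply: (@le_trans _ _ (ln ((m * D).+1%:R ^+ 2))).
    rewrite ler_ln ?posrE ?exprn_gt0 // -natrX ler_nat.
    have : (m * m * D <= m * m * (D * D))%N by rewrite leq_mul2l; nia.
    by rewrite -mulnn; lia.
  rewrite lnXn // -[leLHS]mulr_natl ler_wpM2l // -natr1 addrC natrM le_ln1Dx //.
  by rewrite (lt_le_trans (ltrN10 _)) // mulr_ge0.
have m_gt0 : 0 < m%:R :> R by rewrite ltr0n.
have := dL (m * m)%N; rewrite natrM => le_m.
have := ler_wpM2l (ler0n R k) ln_le => le_k.
rewrite -(ler_pM2l m_gt0); lra.
Qed.

(** * The degeneration for the corner hypergraph of ['F_3] *)

(* The entries 7 sit at the two vertices outside [corner3_set]; they are large
   enough to make every tuple through such a vertex positive. *)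
Definition corner3_weight (i a b : nat) : int :=
  nth 0 (nth [::] (nth [::]
    [:: [:: [:: 7; -2; 2]; [:: -1; 7; 1]; [:: 0; 1; -1]];
        [:: [:: 7; 1; 1]; [:: 0; 7; 2]; [:: -1; -2; -1]];
        [:: [:: 7; 1; -3]; [:: 1; 7; -3]; [:: 1; 1; 2]]] i) a) b.

Definition corner3_set : {set 'F_3 * 'F_3} := ~: [set (0, 0); (1, 1)].

(** A computation over all 18 corners, stated with naturals modulo 3, the form to which addition in
    ['F_3] reduces. *)
Lemma corner3_weight_edge (a b l : nat) :
  (a < 3)%N -> (b < 3)%N -> (0 < l < 3)%N ->
  0 < corner3_weight 0 a b + corner3_weight 1 ((a + l) %% 3) b
      + corner3_weight 2 a ((b + l) %% 3).
Proof. by case: a b l => [|[|[|//]]] [|[|[|//]]] [|[|[|//]]]. Qed.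

(** The degeneration starts from the full diagonal, so the constant tuples at the two excluded
    vertices must be positive as well. *)
Lemma corner3_weight_diag (v : 'F_3 * 'F_3) :
  (if v \in corner3_set then fun x => x == 0 else fun x => 0 < x)
    (corner3_weight 0 v.1 v.2 + corner3_weight 1 v.1 v.2 + corner3_weight 2 v.1 v.2).
Proof.
by case: v => -[[|[|[|//]]] ?] [[|[|[|//]]] ?]; rewrite !inE.
Qed.

Lemma beta_corner3 : (7 <= beta (corner_hypergraph 'F_3))%N.
Proof.
have card_set : #|corner3_set| = 7%N.
  have := cardsC [set (0, 0); (1, 1) : 'F_3 * 'F_3].
  by rewrite cards2 card_prod !card_ord /= => /addnI.
rewrite -card_set; apply: (@leq_bigmax_cond _ _ (fun S : {set 'F_3 * 'F_3} => #|S|)).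
have sumE (x : 3.-tuple ('F_3 * 'F_3)) :
    \sum_(i < 3) corner3_weight i (tnth x i).1 (tnth x i).2 =
    corner3_weight 0 (nth 0 x 0).1 (nth 0 x 0).2
    + corner3_weight 1 (nth 0 x 1).1 (nth 0 x 1).2
    + corner3_weight 2 (nth 0 x 2).1 (nth 0 x 2).2.
  by rewrite !big_ord_recr big_ord0 /= add0r !(tnth_nth 0).
apply/asboolP; split.
  apply/fintype.subsetP => _ /imsetP[v _ ->]; rewrite !inE.
  by apply/orP; right; rewrite imset_f.
exists (fun (i : 'I_3) (v : 'F_3 * 'F_3) => corner3_weight i v.1 v.2); split=> x; last first.
  case/imsetP=> v Sv ->; rewrite sumE /=.
  by have := corner3_weight_diag v; rewrite Sv => /eqP.
rewrite 2!inE => /andP[xS /orP[]].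
  rewrite inE => /existsP[g1 /existsP[g2 /existsP[l /andP[l_neq0 /eqP->]]]].
  rewrite sumE /=; apply: corner3_weight_edge; [exact: ltn_ord g1|exact: ltn_ord g2|].
  by rewrite (ltn_ord l : (l < 3)%N) andbT lt0n.
case/imsetP => v _ xE; rewrite xE sumE /=.
have := corner3_weight_diag v; case: ifP => // Sv.
(* If [v] were in [corner3_set], then [x] would belong to the smaller diagonal, which [xS]
   excludes. *)
by move: xS; rewrite xE imset_f.
Qed.

(** * Comparison of [beta] with [Theta] *)

(** The maximum defaults to 0 on an empty family; a positive value is attained. *)
Lemma beta_witness k (H : hypergraph k) : (0 < beta H)%N ->
  exists2 S : {set vertex H},
    degenerates (edges H :|: Defs.diagonal k [set: vertex H]) (Defs.diagonal k S)
    & beta H = #|S|.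
Proof.
rewrite /beta; elim/big_ind: _ => // [m n IHm IHn|S /asboolP degS _]; last by exists S.
by rewrite /maxn; case: ifP.
Qed.

Lemma beta_le_Theta (R : realType) k (H : hypergraph k.+1) :
  loopless H -> (0 < beta H)%N -> (beta H)%:R <= Theta R H.
Proof.
move=> noloop /[dup] beta_gt0 /beta_witness[S degS betaE].
have [w [c [D wS]]] := degenerates_weighting noloop degS.
rewrite betaE in beta_gt0 *.
pose a n := alpha (strong_power H n).
have le_a n : (#|S| ^ n <= (n * D).+1 ^ k.+1 * a n)%N.
  have [Sn [wn [wSn <-]]] := weighting_strong_power n wS.
  exact: weighting_alpha wSn.
have a_gt0 n : (0 < a n)%N.
  have : (0 < #|S| ^ n)%N by rewrite expn_gt0 beta_gt0.
  by move=> /leq_trans/(_ (le_a n)); rewrite muln_gt0 => /andP[].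
have aR_gt0 n : 0 < (a n)%:R :> R by rewrite ltr0n.
have [|||L cvgL b_le] :=
  @fekete_superadditive R (fun n => ln (a n)%:R) (ln #|vertex H|%:R).
- by move=> n; rewrite ln_ge0 // ler1n.
- move=> m n; rewrite -lnM ?posrE // -natrM ler_ln ?posrE ?ltr0n ?muln_gt0 ?a_gt0 //.
  by rewrite ler_nat; apply: alpha_strong_powerD.
- move=> n; have V_gt0 : (0 < #|vertex H|)%N by apply: leq_trans beta_gt0 (max_card _).
  rewrite mulr_natl -lnXn ?ltr0n // -natrX ler_ln ?posrE ?ltr0n ?expn_gt0 ?V_gt0 //.
  by rewrite ler_nat; apply: alpha_strong_power_le.
have -> : Theta R H = expR L.
  apply/cvg_lim => //.
  (* As [a n > 0], the power is [expR] of [ln (a n) / n], and continuity of [expR] transfers the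
     limit. *)
  under eq_fun => n do rewrite /powR gt_eqF ?aR_gt0 // mulrC.
  by apply: cvg_comp cvgL _; apply: continuous_expR.
rewrite -[leLHS]lnK ?posrE ?ltr0n // ler_expR.
(* Taking logarithms in [le_a] leaves an error of [k.+1] times [ln (n * D).+1]. *)
apply: (@le_of_log_error _ _ _ D k.+1) => n.
apply: (@le_trans _ _ (k.+1%:R * ln (n * D).+1%:R + ln (a n)%:R)); last first.
  by rewrite addrC lerD2r.
rewrite !mulr_natl -!lnXn ?ltr0n // -lnM ?posrE ?exprn_gt0 ?ltr0n //.
rewrite -!natrX -natrM ler_ln ?posrE ?ltr0n ?muln_gt0 ?expn_gt0 ?beta_gt0 ?a_gt0 //.
by rewrite ler_nat.
Qed.

Theorem theorem2p17 (R : realType) :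
  (7 <= beta (corner_hypergraph 'F_3))%N /\
  (7%:R <= Theta R (corner_hypergraph 'F_3))%R.
Proof.
split; first exact: beta_corner3.
have beta_gt0 := leq_trans (isT : (0 < 7)%N) beta_corner3.
apply: le_trans (beta_le_Theta R (@loopless_corner _) beta_gt0).
by rewrite ler_nat beta_corner3.
Qed.
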